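(* Let $t\in\Bbbk^\times$, $V=M(g_{(1\,2)},\rho_t)$ over $\Bbbk G_{\mathbb T_3}$, $0\ne v_a\in V_{g_{(1\,2)}}$, $v_b=t^{-1}g_{(2\,3)}\cdot v_a\in V_{g_{(1\,3)}}$, $v_c=t^{-1}g_{(1\,3)}\cdot v_a\in V_{g_{(2\,3)}}$ (so every $g_x$ acts on $\{v_a,v_b,v_c\}$ by $t$ times the permutation induced by conjugation). (1) If $t=-1$ or $t^2-t+1=0$, then all left coideal subalgebras of $\mathcal B(V)$ in the category of $\mathbb N_0$-graded $\Bbbk G_{\mathbb T_3}$-comodules are generated in degree one. (2) If $t\ne-1$ and $t^2-t+1\ne0$, then $\langle v_b,\ v_av_b-tv_cv_a+t^2v_bv_c\rangle$ is a left coideal subalgebra of $\mathcal B(V)$ in that category which is not generated in degree one.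
   Context: $\Bbbk$ algebraically closed of characteristic $0$. $\mathbb T_3$ is the rack of transpositions of $\mathbb S_3$ under conjugation; $G_{\mathbb T_3}=\langle g_x,x\in\mathbb T_3\mid g_xg_y=g_{xyx^{-1}}g_x\rangle$; the centralizer of $g_{(1\,2)}$ is $\langle g_{(1\,2)}\rangle$ and $\rho_t$ is its character with $g_{(1\,2)}\mapsto t$. $M(g,\rho)=\Bbbk G\otimes_{\Bbbk G^g}\Bbbk v$, $G$ acting on the left, $\deg(h\otimes v)=hgh^{-1}$; it is a Yetter–Drinfeld module over $\Bbbk G$ with braiding $c(v\otimes w)=h\cdot w\otimes v$ for $v$ of degree $h$. $\mathcal B(V)$ is the Nichols algebra. Left coideal subalgebra in the category of $\mathbb N_0$-graded $\Bbbk G$-comodules: $\mathbb N_0$-graded $G$-graded subalgebra $C\ni1$ with $\Delta(C)\subseteq\mathcal B(V)\otimes C$; generated in degree one: generated by $C\cap V$. *)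

(* Defs.v *)
From HB Require Import structures.
From mathcomp Require Import all_boot all_order all_algebra all_fingroup.
Set Implicit Arguments. Unset Strict Implicit. Unset Printing Implicit Defensive.
Import GRing.Theory.
Local Open Scope ring_scope.

(* The rack T_3 of transpositions of S_3.  Letters 0,1,2 : 'I_3 stand for  *)
(* a = (1 2), b = (1 3), c = (2 3)  (with S_3 acting on 'I_3 = {0,1,2}).   *)
Definition tr (x : 'I_3) : 'S_3 :=
  match val x with
  | 0%N => tperm (0 : 'I_3) (1 : 'I_3)
  | 1%N => tperm (0 : 'I_3) (2 : 'I_3)
  | _ => tperm (1 : 'I_3) (2 : 'I_3)
  end.

(* x |> y = x y x^-1 in T_3: x if y = x, the third transposition otherwise *)
Definition rop (x y : 'I_3) : 'I_3 :=
  if x == y then x else inord (3 - x - y).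

Definition word := seq 'I_3.

(* Elements of the (completed) tensor algebra T(V), V = span(v_a,v_b,v_c):   *)
(* coefficient functions on words; the word x1...xn is v_x1 (x) ... (x) v_xn. *)
Definition elt (K : fieldType) := word -> K.

Section Nichols.
Variables (K : fieldType) (t : K).

(* The braiding of V = M(g_(12), rho_t): c(v_x (x) v_y) = t v_(x|>y) (x) v_x. *)
(* Braided (quantum) shuffle of two words, as a formal linear combination:    *)
(*  sh u v = sum over (|u|,|v|)-shuffles s of T_s(u (x) v), T_s the           *)
(*  Matsumoto lift of s built from the braiding c.  Recursion on the first    *)
(*  letter: either it is the first letter x of u, or the first letter y of v, *)
(*  which is braided to the front across all of u.                            *)
Fixpoint sh (u : word) : word -> seq (K * word) :=
  match u with
  | [::] => fun v => [:: (1, v)]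
  | x :: u' => fix shx (v : word) :=
      match v with
      | [::] => [:: (1, u)]
      | y :: v' => [seq (p.1, x :: p.2) | p <- sh u' v] ++
                   [seq (t ^+ size u * p.1, foldr rop y u :: p.2) | p <- shx v']
      end
  end.

Definition coef (L : seq (K * word)) (w : word) : K :=
  \sum_(p <- L | p.2 == w) p.1.

Definition mul (f g : elt K) : elt K := fun w =>
  \sum_(k < (size w).+1) \sum_(u : k.-tuple 'I_3)
     \sum_(v : (size w - k).-tuple 'I_3) f u * g v * coef (sh u v) w.

Definition one : elt K := fun w => (w == [::])%:R.
Definition letter (x : 'I_3) : elt K := fun w => (w == [:: x])%:R.
Definition addE (f g : elt K) : elt K := fun w => f w + g w.
Definition scaleE (a : K) (f : elt K) : elt K := fun w => a * f w.

Inductive gen (S : elt K -> Prop) : elt K -> Prop :=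
  | gen_one : gen S one
  | gen_base f : S f -> gen S f
  | gen_add f g : gen S f -> gen S g -> gen S (addE f g)
  | gen_scale a f : gen S f -> gen S (scaleE a f)
  | gen_mul f g : gen S f -> gen S g -> gen S (mul f g).

(* The Nichols algebra B(V): the subalgebra of the quantum shuffle algebra *)
(* generated by V; its coproduct is deconcatenation.                       *)
Definition nichols : elt K -> Prop := gen (fun f => exists x, f = letter x).

Definition Delta (f : elt K) : word -> word -> K := fun u v => f (u ++ v).

Definition tens_in (P Q : elt K -> Prop) (F : word -> word -> K) : Prop :=
  exists n (b c : 'I_n -> elt K), (forall i, P (b i) /\ Q (c i)) /\
    forall u v, F u v = \sum_(i < n) b i u * c i v.

Definition homog (n : nat) (f : elt K) : Prop := forall w, size w != n -> f w = 0.
Definition hpart (n : nat) (f : elt K) : elt K :=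
  fun w => if size w == n then f w else 0.
(* G_{T_3}-degree of a word x1..xn is g_x1...g_xn; G_{T_3} embeds in       *)
(* S_3 x Z via g_x |-> (x, 1), so the degree is (product in S_3, length).  *)
Definition gdeg (w : word) : 'S_3 := foldr (fun x s => (tr x * s)%g) 1%g w.
Definition gpart (s : 'S_3) (n : nat) (f : elt K) : elt K :=
  fun w => if (gdeg w == s) && (size w == n) then f w else 0.

Definition left_coideal_subalg (C : elt K -> Prop) : Prop :=
  (forall f, C f -> nichols f) /\
  C one /\
  (forall f g, C f -> C g -> C (addE f g)) /\
  (forall a f, C f -> C (scaleE a f)) /\
  (forall f g, C f -> C g -> C (mul f g)) /\
  (forall n f, C f -> C (hpart n f)) /\
  (forall s n f, C f -> C (gpart s n f)) /\
  (forall f, C f -> tens_in nichols C (Delta f)).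

Definition gen_in_degree_one (C : elt K -> Prop) : Prop :=
  forall f, C f <-> gen (fun g => C g /\ homog 1 g) f.

Definition va : elt K := letter 0.
Definition vb : elt K := letter 1.
Definition vc : elt K := letter 2.

Definition w2 : elt K :=
  addE (addE (mul va vb) (scaleE (- t) (mul vc va))) (scaleE (t ^+ 2) (mul vb vc)).

Definition C2 : elt K -> Prop := gen (fun f => f = vb \/ f = w2).

End Nichols.

Lemma rop_conj (x y : 'I_3) : tr (rop x y) = (tr y ^ tr x)%g.
Proof.
apply/permP => i; rewrite conjgE !permM.
case: x => [[|[|[|//]]] ?]; case: y => [[|[|[|//]]] ?];
  case: i => [[|[|[|//]]] ?]; apply/val_inj; rewrite /rop /tr /= ?inordK //=;
  rewrite ?tpermV !permE /=; by [].
Qed.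

(* Main.v *)
Require Import Defs.
From HB Require Import structures.
From mathcomp Require Import all_boot all_order all_algebra all_fingroup.
From mathcomp Require Import ring.
From Stdlib Require Import FunctionalExtensionality Classical.
Import GRing.Theory.
Local Open Scope ring_scope.
Set Implicit Arguments. Unset Strict Implicit. Unset Printing Implicit Defensive.

(* Everything rests on the first-letter recursion of the quantum shuffle      *)
(* product (mul_cons); in particular left multiplication by a letter is given *)
(* by mul_letter_cons.  The quadratic element v_a v_b - t v_c v_a + t^2 v_b   *)
(* v_c equals (1 + t^3) times the word ab.                                    *)
(* If t^3 = -1, let C be a left coideal subalgebra.  An element of C vanishes *)
(* on all words whose last letter is not in C.  If a is the only letter       *)
(* outside C, then the quadratic relations give B(V) = E K[a] with E          *)
(* generated by the other two letters, and stripping final letters a shows    *)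
(* that an element without words ending in a lies in E.  If b is the only     *)
(* letter in C, a linear relation between the values of an element of B(V) on *)
(* the words of length 2 forces C to be supported on the words b^n.           *)
(* If t^3 <> -1, Delta w2 = w2 (x) 1 + (1 + t^3) v_a (x) v_b + 1 (x) w2, and  *)
(* the middle term only involves v_b on the right.                            *)

(** Since 1 + t^3 = (t + 1)(t^2 - t + 1), the dichotomy is whether t^3 = -1. In the shuffle
    realisation the coproduct is deconcatenation, so the coideal condition becomes a condition on
    coefficients of words.

    Let t^3 = -1. The quadratic relations ([letter_quad]) have a dual form, a linear relation
    between coefficients ([nichols_quad]). By [coideal_last], a letter missing from a left coideal
    subalgebra C ends no word in the support of an element of C. If no letter is missing, C is
    everything. If only a is missing, [rder0_gen_other] puts C inside the subalgebra generated by
    the other two letters. If two are missing, [coideal_restr] confines C to powers of the third,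
    and to scalars if that one is missing too. So C is always generated by its letters.

    Let t^3 <> -1. The mixed term of Delta w2 has only v_b on the right ([Delta_mul_w2]), and the
    three monomials of w2 share one degree ([C2_part]), so [C2] is a graded left coideal subalgebra.
    Its degree-one part is spanned by v_b; polynomials in v_b vanish on the word ab, where w2 takes
    the value 1 + t^3. *)

Lemma ord3P (P : 'I_3 -> Prop) : P 0 -> P 1 -> P 2 -> forall x, P x.
Proof.
move=> P0 P1 P2 [[|[|[|//]]] lt3].
- by have -> : Ordinal lt3 = 0 by apply/val_inj.
- by have -> : Ordinal lt3 = 1 by apply/val_inj.
- by have -> : Ordinal lt3 = 2 by apply/val_inj.
Qed.

Lemma ropE :
  ((rop 0 0 = 0) * (rop 0 1 = 2) * (rop 0 2 = 1) *
   (rop 1 0 = 2) * (rop 1 1 = 1) * (rop 1 2 = 0) *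
   (rop 2 0 = 1) * (rop 2 1 = 0) * (rop 2 2 = 2))%type.
Proof. by do !split; apply/val_inj; rewrite /rop /= ?inordK. Qed.

Lemma ropxx x : rop x x = x.
Proof. by rewrite /rop eqxx. Qed.

Lemma ropK x : involutive (rop x).
Proof. by elim/ord3P: x; elim/ord3P; rewrite !ropE. Qed.

Lemma rop_inj x : injective (rop x).
Proof. exact: inv_inj (ropK x). Qed.

Lemma eq_rop x y z : (rop x y == z) = (y == rop x z).
Proof. by rewrite (can2_eq (ropK x) (ropK x)). Qed.

Lemma rop_distr x y z : rop x (rop y z) = rop (rop x y) (rop x z).
Proof. by elim/ord3P: x; elim/ord3P: y; elim/ord3P: z; rewrite !ropE. Qed.

Lemma rop_neq x y : x != y -> rop x y != y.
Proof. by elim/ord3P: x; elim/ord3P: y; rewrite ?ropE. Qed.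

Lemma rop_third x y z : x != y -> z != x -> z != y -> z = rop x y.
Proof. by elim/ord3P: x; elim/ord3P: y; elim/ord3P: z; rewrite ?ropE. Qed.

Lemma tr_inj : injective tr.
Proof.
move=> x y /(congr1 (fun s : 'S_3 => (s 0, s 1))).
by elim/ord3P: x; elim/ord3P: y; rewrite /tr /= !permE.
Qed.

Lemma trV x : (tr x)^-1%g = tr x.
Proof. by elim/ord3P: x; rewrite /tr /= tpermV. Qed.

(** The relation g_x g_y = g_(x|>y) g_x: braiding preserves degrees. *)
Lemma gdeg_swap x y (w : word) : gdeg (x :: y :: w) = gdeg (rop x y :: x :: w).
Proof. by rewrite /= rop_conj conjgE !mulgA -{4}(trV x) mulgK trV. Qed.

(** * First-letter recursion for the quantum shuffle product *)

Section QuantumShuffle.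
Variables (K : fieldType) (t : K).
Implicit Types (f g h : elt K) (u v w : word) (x y z : 'I_3).
Local Notation "f ** g" := (Defs.mul t f g) (at level 40, left associativity).
Local Notation ltr x := (letter K x).
Local Notation one := (Defs.one K).

Lemma elt_ext f g : (forall w, f w = g w) -> f = g.
Proof. exact: functional_extensionality. Qed.

Definition lder z f : elt K := fun w => f (z :: w).

(* The part of f of the degrees whose action takes v_y to a multiple of v_z,  *)
(* rescaled by that action.                                                   *)
Definition twist y z f : elt K := fun u =>
  if foldr rop y u == z then t ^+ size u * f u else 0.

Lemma sum_tuple0 (F : word -> K) : \sum_(u : 0.-tuple 'I_3) F u = F [::].
Proof.
rewrite (big_pred1 [tuple]) // => u; apply/esym/eqP.
by rewrite tuple0.
Qed.

Lemma sum_tupleS {n} (F : word -> K) :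
  \sum_(u : n.+1.-tuple 'I_3) F u =
  \sum_x \sum_(u : n.-tuple 'I_3) F (x :: u).
Proof.
rewrite pair_big /=.
rewrite (reindex (fun p : 'I_3 * n.-tuple 'I_3 => cons_tuple p.1 p.2)) //=.
exists (fun u : n.+1.-tuple 'I_3 => (thead u, behead_tuple u)).
  by case=> x u _ /=; congr pair; apply/val_inj.
by move=> u _; apply/val_inj; rewrite /= [in RHS](tuple_eta u).
Qed.

Lemma coef_cat (L1 L2 : seq (K * word)) w :
  coef (L1 ++ L2) w = coef L1 w + coef L2 w.
Proof. by rewrite /coef big_cat. Qed.

Lemma coef1 a u w : coef [:: (a : K, u)] w = a * (u == w)%:R.
Proof.
by rewrite /coef big_cons big_nil /=; case: (u == w); rewrite ?mulr1 ?mulr0 ?addr0.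
Qed.

Lemma coef_cons a x (L : seq (K * word)) z w :
  coef [seq (a * p.1, x :: p.2) | p <- L] (z :: w) =
  a * (x == z)%:R * coef L w.
Proof.
rewrite /coef big_map /= mulr_sumr.
rewrite [LHS]big_mkcond [RHS]big_mkcond /=; apply: eq_bigr => p _.
rewrite eqseq_cons; case: (x == z); case: (p.2 == w) => //=.
  by rewrite mulr1.
by rewrite mulr0 mul0r.
Qed.

Lemma sh_nil_r u : sh t u [::] = [:: (1, u)].
Proof. by case: u. Qed.

Lemma coef_sh_cons x u y v z w :
  coef (sh t (x :: u) (y :: v)) (z :: w) =
  (x == z)%:R * coef (sh t u (y :: v)) w +
  (foldr rop y (x :: u) == z)%:R * t ^+ (size u).+1 * coef (sh t (x :: u) v) w.
Proof.
rewrite [sh t (x :: u) (y :: v)]/= coef_cat; congr (_ + _).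
  rewrite -[(x == z)%:R]mul1r -coef_cons; congr (coef _ _).
  by apply: eq_map => p; rewrite mul1r.
by rewrite [_%:R * _]mulrC; exact: coef_cons.
Qed.

Definition mul_kl k l f g w : K :=
  \sum_(u : k.-tuple 'I_3) \sum_(v : l.-tuple 'I_3)
    f u * g v * coef (sh t u v) w.

Lemma mul_0l l f g z w :
  mul_kl 0 l.+1 f g (z :: w) = \sum_y mul_kl 0 l (twist y z f) (lder y g) w.
Proof.
rewrite /mul_kl (sum_tuple0 (fun u => \sum_(v : l.+1.-tuple 'I_3)
  f u * g v * coef (sh t u v) (z :: w))).
rewrite (sum_tupleS (fun v => f [::] * g v * coef (sh t [::] v) (z :: w))).
apply: eq_bigr => y _.
rewrite (sum_tuple0 (fun u => \sum_(v : l.-tuple 'I_3)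
  twist y z f u * lder y g v * coef (sh t u v) w)).
apply: eq_bigr => v _; rewrite /= !coef1 eqseq_cons /twist /lder /= expr0 !mul1r.
by case: (y == z); rewrite ?mulr0 ?mul0r.
Qed.

Lemma mul_k0 k f g z w :
  mul_kl k.+1 0 f g (z :: w) = mul_kl k 0 (lder z f) g w.
Proof.
rewrite /mul_kl (sum_tupleS (fun u => \sum_(v : 0.-tuple 'I_3)
  f u * g v * coef (sh t u v) (z :: w))) exchange_big /=.
apply: eq_bigr => u _; rewrite exchange_big /=.
rewrite (sum_tuple0 (fun v => \sum_x f (x :: u) * g v * coef (sh t (x :: u) v) (z :: w))).
rewrite (sum_tuple0 (fun v => lder z f u * g v * coef (sh t u v) w)) sh_nil_r.
rewrite (bigD1 z) //= big1 ?addr0 => [|x xz]; rewrite !coef1 eqseq_cons ?eqxx //.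
by rewrite (negPf xz) !mulr0.
Qed.

Lemma mul_kl_cons k l f g z w :
  mul_kl k.+1 l.+1 f g (z :: w) =
  mul_kl k l.+1 (lder z f) g w +
  \sum_y mul_kl k.+1 l (twist y z f) (lder y g) w.
Proof.
transitivity (\sum_x \sum_(u : k.-tuple 'I_3) \sum_(v : l.+1.-tuple 'I_3)
    (x == z)%:R * (lder x f u * g v * coef (sh t u v) w) +
  \sum_(u : k.+1.-tuple 'I_3) \sum_y \sum_(v : l.-tuple 'I_3)
     (twist y z f u * lder y g v * coef (sh t u v) w)); last first.
  rewrite /mul_kl; congr (_ + _); last by rewrite exchange_big.
  rewrite (bigD1 z) //= [X in _ + X]big1 ?addr0 => [|x xz].
    by apply: eq_bigr => u _; apply: eq_bigr => v _; rewrite eqxx mul1r.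
  by apply: big1 => u _; apply: big1 => v _; rewrite (negPf xz) mul0r.
rewrite /mul_kl (sum_tupleS (fun u => \sum_(v : l.+1.-tuple 'I_3)
  f u * g v * coef (sh t u v) (z :: w))).
rewrite (sum_tupleS (fun u => \sum_y \sum_(v : l.-tuple 'I_3)
  twist y z f u * lder y g v * coef (sh t u v) w)).
rewrite -big_split; apply: eq_bigr => x _; rewrite -big_split; apply: eq_bigr => u _.
rewrite [in RHS](sum_tupleS (fun v => (x == z)%:R * (lder x f u * g v * coef (sh t u v) w))).
rewrite (sum_tupleS (fun v => f (x :: u) * g v * coef (sh t (x :: u) v) (z :: w))).
rewrite -big_split; apply: eq_bigr => y _; rewrite -big_split; apply: eq_bigr => v _.
rewrite coef_sh_cons /lder /twist.
by case: (foldr rop y (x :: u) == z) => /=; ring.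
Qed.

Lemma mul_nil f g : (f ** g) [::] = f [::] * g [::].
Proof.
rewrite /Defs.mul big_ord1.
rewrite (sum_tuple0 (fun u => \sum_(v : (size ([::] : word) - 0).-tuple 'I_3)
  f u * g v * coef (sh t u v) [::])) /=.
by rewrite (sum_tuple0 (fun v => f [::] * g v * coef [:: (1, v)] [::])) coef1 eqxx !mulr1.
Qed.

(** The first letter of a shuffle comes from [f], or it is a letter y of [g] that braids across all
    of [f] and arrives as z, which [twist y z] records. *)
Lemma mul_cons f g z w :
  (f ** g) (z :: w) =
  (lder z f ** g) w + \sum_y (twist y z f ** lder y g) w.
Proof.
(* For k = [size w] the right factor has degree 0 and cannot supply the first letter, whence the
   conditional. *)
have step (k : 'I_(size w).+1) :
    mul_kl k.+1 (size w - k) f g (z :: w) = mul_kl k (size w - k) (lder z f) g w +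
    (if (k < size w)%N then
       \sum_y mul_kl k.+1 (size w - k.+1) (twist y z f) (lder y g) w else 0).
  case: ltnP => [lt_k|ge_k]; first by rewrite -(subnSK lt_k) mul_kl_cons.
  have -> : (size w - k = 0)%N by apply/eqP; rewrite subn_eq0.
  by rewrite mul_k0 addr0.
rewrite /Defs.mul /= -!/(mul_kl _ _ _ _ _) big_ord_recl /= -/(mul_kl 0 _ f g _).
rewrite subn0 mul_0l.
transitivity (\sum_y mul_kl 0 (size w) (twist y z f) (lder y g) w +
  \sum_(k < (size w).+1) mul_kl k.+1 (size w - k) f g (z :: w)) => //.
rewrite (eq_bigr _ (fun k _ => step k)) big_split /= addrCA; congr (_ + _).
under [RHS]eq_bigr do rewrite big_ord_recl /= subn0.
rewrite [RHS]big_split; congr (_ + _).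
rewrite big_ord_recr /= ltnn addr0 exchange_big /=.
by apply: eq_bigr => k _; rewrite ltn_ord.
Qed.

Lemma qmul_suml (I : finType) (F : I -> elt K) g w :
  ((fun u => \sum_i F i u) ** g) w = \sum_i (F i ** g) w.
Proof.
rewrite /Defs.mul [RHS]exchange_big; apply: eq_bigr => k _.
rewrite [RHS]exchange_big; apply: eq_bigr => u _.
rewrite [RHS]exchange_big; apply: eq_bigr => v _.
by rewrite /= !mulr_suml.
Qed.

Lemma qmul_sumr (I : finType) (F : I -> elt K) g w :
  (g ** (fun u => \sum_i F i u)) w = \sum_i (g ** F i) w.
Proof.
rewrite /Defs.mul [RHS]exchange_big; apply: eq_bigr => k _.
rewrite [RHS]exchange_big; apply: eq_bigr => u _.
rewrite [RHS]exchange_big; apply: eq_bigr => v _.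
by rewrite /= [X in X * coef _ _]mulr_sumr mulr_suml.
Qed.

Lemma qmulDl f g h : addE f g ** h = addE (f ** h) (g ** h).
Proof.
apply: elt_ext => w; rewrite /Defs.mul /addE -big_split; apply: eq_bigr => k _.
rewrite -big_split; apply: eq_bigr => u _; rewrite -big_split; apply: eq_bigr => v _.
by rewrite !mulrDl.
Qed.

Lemma qmulDr f g h : h ** addE f g = addE (h ** f) (h ** g).
Proof.
apply: elt_ext => w; rewrite /Defs.mul /addE -big_split; apply: eq_bigr => k _.
rewrite -big_split; apply: eq_bigr => u _; rewrite -big_split; apply: eq_bigr => v _.
by rewrite mulrDr mulrDl.
Qed.

Lemma qmulZl a f g : scaleE a f ** g = scaleE a (f ** g).
Proof.
apply: elt_ext => w; rewrite /Defs.mul /scaleE mulr_sumr; apply: eq_bigr => k _.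
rewrite mulr_sumr; apply: eq_bigr => u _; rewrite mulr_sumr; apply: eq_bigr => v _.
by rewrite !mulrA.
Qed.

Lemma qmulZr a f g : f ** scaleE a g = scaleE a (f ** g).
Proof.
apply: elt_ext => w; rewrite /Defs.mul /scaleE mulr_sumr; apply: eq_bigr => k _.
rewrite mulr_sumr; apply: eq_bigr => u _; rewrite mulr_sumr; apply: eq_bigr => v _.
by rewrite [f u * _]mulrCA !mulrA.
Qed.

(** * Associativity and unit *)

Lemma foldr_rop u x y :
  foldr rop (rop x y) u = rop (foldr rop x u) (foldr rop y u).
Proof. by elim: u => //= z u ->; rewrite rop_distr. Qed.

Lemma lder_mul z f g :
  lder z (f ** g) =
  addE (lder z f ** g) (fun w => \sum_y (twist y z f ** lder y g) w).
Proof. by apply: elt_ext => w; rewrite /lder mul_cons. Qed.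

Lemma lder_twist x y z f :
  lder x (twist y z f) = scaleE t (twist y (rop x z) (lder x f)).
Proof.
apply: elt_ext => w; rewrite /lder /twist /scaleE /= eq_rop exprS -mulrA.
by case: ifP => // _; rewrite mulr0.
Qed.

Lemma twist_twist x y z z' f :
  twist y z' (twist (rop y x) z f) = twist x (rop z' z) (twist y z' f).
Proof.
apply: elt_ext => w; rewrite /twist foldr_rop.
case: eqP => [->|_]; last by rewrite mulr0 if_same.
by rewrite eq_rop; case: ifP; rewrite ?mulr0.
Qed.

(** A letter y crossing a product first crosses [g], becoming some x, and then [f], becoming z. *)
Lemma twist_mul y z f g :
  twist y z (f ** g) = fun w => \sum_x (twist x z f ** twist y x g) w.
Proof.
apply: elt_ext => w; elim: w y z f g => [|z' w IH] y z f g.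
  under eq_bigr do rewrite mul_nil /twist /= expr0 !mul1r.
  rewrite /twist /= mul_nil expr0 mul1r (bigD1 z) //= eqxx big1 ?addr0 => [|x xz].
    by case: ifP; rewrite ?mulr0.
  by rewrite (negPf xz) mul0r.
transitivity (lder z' (twist y z (f ** g)) w) => //.
rewrite lder_twist lder_mul.
have twistD h h' y' : twist y y' (addE h h') = addE (twist y y' h) (twist y y' h').
  by apply: elt_ext => u; rewrite /twist /addE; case: ifP; rewrite ?addr0 ?mulrDr.
have twist_sum (F : 'I_3 -> elt K) y' v :
    twist y y' (fun u => \sum_x F x u) v = \sum_x twist y y' (F x) v.
  rewrite /twist; case: ifP => _; last by rewrite big1.
  by rewrite mulr_sumr.
rewrite twistD /scaleE /addE /= IH twist_sum mulrDr !mulr_sumr.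
under [RHS]eq_bigr do rewrite mul_cons lder_twist qmulZl.
rewrite [RHS]big_split; congr (_ + _).
rewrite (eq_bigr _ (fun i _ => congr1 _ (IH y (rop z' z) (twist i z' f) (lder i g)))).
under [RHS]eq_bigr do under eq_bigr do rewrite lder_twist qmulZr /scaleE.
rewrite [RHS]exchange_big; apply: eq_bigr => y' _.
rewrite mulr_sumr [RHS](reindex_inj (@rop_inj y')); apply: eq_bigr => x _.
by rewrite twist_twist ropK.
Qed.

Lemma qmulA f g h : f ** (g ** h) = f ** g ** h.
Proof.
apply: elt_ext => w; elim: w f g h => [|z w IH] f g h.
  by rewrite !mul_nil mulrA.
rewrite !mul_cons lder_mul qmulDl {1}/addE qmul_suml IH -addrA; congr (_ + _).
under eq_bigr do rewrite lder_mul qmulDr /addE qmul_sumr IH.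
rewrite big_split; congr (_ + _).
under [RHS]eq_bigr do rewrite twist_mul qmul_suml.
rewrite [RHS]exchange_big; apply: eq_bigr => x _; apply: eq_bigr => y _.
by rewrite IH.
Qed.

Lemma qmul0l f : (fun=> 0) ** f = fun=> 0.
Proof.
apply: elt_ext => w; rewrite /Defs.mul big1 // => k _.
by rewrite big1 // => u _; rewrite big1 // => v _; rewrite !mul0r.
Qed.

Lemma qmul0r f : f ** (fun=> 0) = fun=> 0.
Proof.
apply: elt_ext => w; rewrite /Defs.mul big1 // => k _.
by rewrite big1 // => u _; rewrite big1 // => v _; rewrite mulr0 mul0r.
Qed.

Lemma lder_one z : lder z one = fun=> 0.
Proof. by apply: elt_ext. Qed.

Lemma qmul1l f : one ** f = f.
Proof.
apply: elt_ext => w; elim: w f => [|z w IH] f; first by rewrite mul_nil mul1r.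
rewrite mul_cons lder_one qmul0l add0r (bigD1 z) //= big1 ?addr0 => [|y yz].
  rewrite -[RHS](IH (lder z f)); congr (Defs.mul t _ _ w).
  apply: elt_ext => -[|x u]; rewrite /twist /Defs.one /= ?eqxx ?mul1r //.
  by rewrite mulr0 if_same.
have -> : twist y z one = fun=> 0; last by rewrite qmul0l.
apply: elt_ext => -[|x u]; rewrite /twist /Defs.one /= ?(negPf yz) //.
by rewrite mulr0 if_same.
Qed.

Lemma qmul1r f : f ** one = f.
Proof.
apply: elt_ext => w; elim: w f => [|z w IH] f; first by rewrite mul_nil mulr1.
by rewrite mul_cons IH big1 ?addr0 // => y _; rewrite lder_one qmul0r.
Qed.

(** * Generated subalgebras and left multiplication by letters *)

Lemma gen_left_ind (S P : elt K -> Prop) :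
  P one ->
  (forall f g, P f -> P g -> P (addE f g)) ->
  (forall a f, P f -> P (scaleE a f)) ->
  (forall s f, S s -> P f -> P (s ** f)) ->
  forall f, gen t S f -> P f.
Proof.
move=> P1 PD PZ PM f Sf.
(* Generalised to all right factors, so that products follow by associativity. *)
suff: forall g, P g -> P (f ** g) by move/(_ _ P1); rewrite qmul1r.
elim: Sf => [|f1 Sf1|f1 g1 _ IHf _ IHg|a f1 _ IH|f1 g1 _ IHf _ IHg] g Pg.
- by rewrite qmul1l.
- by apply: PM.
- by rewrite qmulDl; apply: PD; [exact: IHf|exact: IHg].
- by rewrite qmulZl; apply: PZ; exact: IH.
by rewrite -qmulA; apply/IHf/IHg.
Qed.

Lemma gen_sub (S S' : elt K -> Prop) :
  (forall f, S f -> gen t S' f) -> forall f, gen t S f -> gen t S' f.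
Proof.
move=> sub f; elim=> *; by [exact: gen_one|exact: sub|exact: gen_add|
  exact: gen_scale|exact: gen_mul].
Qed.

Lemma mul_letter_nil x f : (ltr x ** f) [::] = 0.
Proof. by rewrite mul_nil [ltr x _]/= mul0r. Qed.

Lemma lder_letter z x : lder z (ltr x) = scaleE (x == z)%:R one.
Proof.
apply: elt_ext => u; rewrite /lder /scaleE /Defs.one /letter eqseq_cons eq_sym.
by rewrite -natrM mulnb.
Qed.

Lemma mul_letter_cons x f z w :
  (ltr x ** f) (z :: w) =
  (x == z)%:R * f w + t * (ltr x ** lder (rop x z) f) w.
Proof.
rewrite mul_cons lder_letter qmulZl qmul1l; congr (_ + _).
rewrite (bigD1 (rop x z)) //= big1 ?addr0 => [|y yz].
  have -> : twist (rop x z) z (ltr x) = scaleE t (ltr x); last by rewrite qmulZl.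
  apply: elt_ext => u; rewrite /twist /scaleE /letter.
  case: (u =P [:: x]) => [->|_] /=; first by rewrite ropK eqxx expr1.
  by rewrite !mulr0 if_same.
have -> : twist y z (ltr x) = fun=> 0; last by rewrite qmul0l.
apply: elt_ext => u; rewrite /twist /letter.
case: (u =P [:: x]) => [->|_] /=; last by rewrite mulr0 if_same.
by rewrite eq_rop (negPf yz).
Qed.

Lemma nichols_ind (P : elt K -> Prop) :
  P one ->
  (forall f g, P f -> P g -> P (addE f g)) ->
  (forall a f, P f -> P (scaleE a f)) ->
  (forall x f, P f -> P (ltr x ** f)) ->
  forall f, nichols t f -> P f.
Proof.
by move=> P1 PD PZ PM; apply: gen_left_ind => // s f [x ->]; exact: PM.
Qed.

Lemma addE0 f : addE f (fun=> 0) = f.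
Proof. by apply: elt_ext => w; rewrite /addE addr0. Qed.

Lemma gen0 (S : elt K -> Prop) : gen t S (fun=> 0).
Proof.
have -> : (fun=> 0) = scaleE 0 one by apply: elt_ext => w; rewrite /scaleE mul0r.
exact/gen_scale/gen_one.
Qed.

Lemma gen_sum (S : elt K -> Prop) n (F : 'I_n -> elt K) :
  (forall i, gen t S (F i)) -> gen t S (fun w => \sum_i F i w).
Proof.
elim: n F => [|n IH] F SF.
  have -> : (fun w => \sum_i F i w) = fun=> 0 by apply: elt_ext => w; rewrite big_ord0.
  exact: gen0.
have -> : (fun w => \sum_i F i w) =
    addE (F ord0) (fun w => \sum_(i < n) F (lift ord0 i) w).
  by apply: elt_ext => w; rewrite big_ord_recl.
by apply: gen_add => //; exact: IH.
Qed.

Lemma mul_letter1 x f z : (ltr x ** f) [:: z] = (x == z)%:R * f [::].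
Proof. by rewrite mul_letter_cons mul_letter_nil mulr0 addr0. Qed.

Lemma mul_letter2 z f x y :
  (ltr z ** f) [:: x; y] =
  (z == x)%:R * f [:: y] + t * (z == y)%:R * f [:: rop z x].
Proof. by rewrite mul_letter_cons mul_letter1 mulrA. Qed.

Lemma mul_letters x y w :
  (ltr x ** ltr y) w = (w == [:: x; y])%:R + t * (w == [:: rop x y; x])%:R.
Proof.
case: w => [|z w]; first by rewrite mul_letter_nil mulr0 addr0.
rewrite mul_letter_cons lder_letter qmulZr qmul1r /scaleE /letter !eqseq_cons.
by rewrite [y == _]eq_sym eq_rop ![x == z]eq_sym -!natrM !mulnb.
Qed.

(** * Quadratic relations for t^3 = -1 *)

Section CubeRoot.
Hypothesis t3 : t ^+ 3 = -1.

Lemma letter_quad x y : x != y ->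
  ltr x ** ltr y = addE (scaleE t (ltr (rop x y) ** ltr x))
                        (scaleE (- t ^+ 2) (ltr y ** ltr (rop x y))).
Proof.
move=> xy; apply: elt_ext => w; rewrite /addE /scaleE !mul_letters.
have -> : rop (rop x y) x = y by move: xy; elim/ord3P: x; elim/ord3P: y; rewrite ?ropE.
have -> : rop y (rop x y) = x by move: xy; elim/ord3P: x; elim/ord3P: y; rewrite ?ropE.
rewrite [RHS](_ : _ = - t ^+ 3 * (w == [:: x; y])%:R + t * (w == [:: rop x y; x])%:R).
  by rewrite t3 opprK mul1r.
by ring.
Qed.

(** This functional kills every product of two letters: such a product meets none or two of the
    three words, and the two contributions cancel, for v_x v_y because t^3 = -1. *)
Lemma nichols_quad h x y : nichols t h -> x != y ->
  h [:: x; y] + t ^+ 2 * h [:: rop x y; x] = t * h [:: y; rop x y].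
Proof.
move=> Bh xy; elim/nichols_ind: h / Bh => [|f g Hf Hg|a f Hf|z f Hf].
- by rewrite /Defs.one !mulr0 addr0.
- by rewrite /addE !mulrDr -Hf -Hg addrACA.
- by rewrite /scaleE [t ^+ 2 * _]mulrCA -mulrDr Hf mulrCA.
rewrite !mul_letter2.
have t3f a : a + t ^+ 2 * (t * a) = 0.
  by rewrite mulrA -exprSr t3 mulN1r subrr.
clear Hf; move: xy; elim/ord3P: x; elim/ord3P: y; elim/ord3P: z => //= _;
  rewrite !ropE /= ?mulr0n ?mulr1n ?mulr0 ?mul0r ?add0r ?addr0 ?mulr0 ?mul1r
    ?mulr1 ?t3f //; ring.
Qed.

(* Restriction to the powers of v_b; on the Nichols algebra it maps onto      *)
(* K[v_b], so powers b^n with [n]_t! = 0 need no separate treatment.          *)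
Definition restr b f : elt K := fun w => if all (pred1 b) w then f w else 0.

Lemma lder_restr b z f :
  lder z (restr b f) = if z == b then restr b (lder z f) else fun=> 0.
Proof. by apply: elt_ext => w; rewrite /lder /restr /=; case: (z == b). Qed.

(** The letter z keeps its name when others braid across it, so it survives the restriction only if
    z = b; and a letter crossing b becomes b only if it was b. *)
Lemma restr_mul b z f :
  restr b (ltr z ** f) = if z == b then ltr z ** restr b f else fun=> 0.
Proof.
apply: elt_ext => w; rewrite /restr.
case: (eqVneq z b) => [->{z}|zb]; last first.
  case: ifP => //; elim: w f => [|x w IH] f /=; first by rewrite mul_letter_nil.
  move=> /andP[/eqP-> wb]; rewrite mul_letter_cons (negPf zb) mul0r add0r.
  by rewrite IH // mulr0.
elim: w f => [|x w IH] f; first by rewrite !mul_letter_nil.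
rewrite !mul_letter_cons -/(restr b f) lder_restr eq_rop ropxx [b == x]eq_sym /=.
case: (eqVneq x b) => [->|_] /=; last by rewrite qmul0r mul0r mulr0 addr0.
rewrite -/(restr b _) ropxx -IH /restr.
by case: ifP; rewrite // !mulr0 addr0.
Qed.

Lemma restr_nichols b f : nichols t f -> gen t (fun g => g = ltr b) (restr b f).
Proof.
elim/nichols_ind => [|f1 f2 H1 H2|a f1 H1|z f1 H1].
- have -> : restr b one = one by apply: elt_ext => -[|x w]; rewrite /restr ?if_same.
  exact: gen_one.
- have -> : restr b (addE f1 f2) = addE (restr b f1) (restr b f2).
    by apply: elt_ext => w; rewrite /restr /addE; case: ifP; rewrite ?addr0.
  exact: gen_add.
- have -> : restr b (scaleE a f1) = scaleE a (restr b f1).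
    by apply: elt_ext => w; rewrite /restr /scaleE; case: ifP; rewrite ?mulr0.
  exact: gen_scale.
rewrite restr_mul; case: eqP => [->|_]; last exact: gen0.
by apply: gen_mul => //; exact: gen_base.
Qed.

(** * Decomposition of the Nichols algebra along one letter *)

Definition gen_other a : elt K -> Prop :=
  gen t (fun g => exists2 x, x != a & g = ltr x).

(* [pow_word a n] is v_a^n divided by the quantum factorial [n]_t!, which may *)
(* vanish.                                                                    *)
Definition pow_word a n : elt K := fun w => (w == nseq n a)%:R.

Lemma lder_pow_word a n z :
  lder z (pow_word a n.+1) = scaleE (z == a)%:R (pow_word a n).
Proof.
by apply: elt_ext => w; rewrite /lder /pow_word /scaleE eqseq_cons -natrM mulnb.
Qed.

Lemma mul_letter_pow a n :
  exists c, ltr a ** pow_word a n = scaleE c (pow_word a n.+1).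
Proof.
elim: n => [|n [c IH]].
  exists 1; rewrite (_ : pow_word a 0 = one) // qmul1r.
  by apply: elt_ext => w; rewrite /scaleE mul1r.
exists (1 + t * c); apply: elt_ext => -[|z w].
  by rewrite mul_letter_nil /scaleE mulr0.
rewrite mul_letter_cons lder_pow_word qmulZr IH eq_rop ropxx [a == z]eq_sym.
rewrite /scaleE /pow_word eqseq_cons; case: (z == a) => /=; ring.
Qed.

(** The relation v_a v_x = t v_(a|>x) v_a - t^2 v_x v_(a|>x) moves v_a to the right, and a |> x
    again differs from a. *)
Lemma mul_letter_other a e : gen_other a e ->
  exists e1 e2, [/\ gen_other a e1, gen_other a e2 &
                    ltr a ** e = addE (e1 ** ltr a) e2].
Proof.
(* Membership of e is kept in the invariant because the last term of the relation multiplies the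
   remaining factor itself. *)
move=> Ee; suff [] : gen_other a e /\ exists e1 e2, [/\ gen_other a e1,
  gen_other a e2 & ltr a ** e = addE (e1 ** ltr a) e2] by [].
elim/gen_left_ind: e / Ee => [|f g [Ef [f1 [f2 [Ef1 Ef2 mf]]]] [Eg [g1 [g2 [Eg1 Eg2 mg]]]]
  |k f [Ef [f1 [f2 [Ef1 Ef2 mf]]]]|_ f [x xa ->] [Ef [f1 [f2 [Ef1 Ef2 mf]]]]]; split.
- exact: gen_one.
- exists one, (fun=> 0); split; [exact: gen_one|exact: gen0|].
  by rewrite qmul1r qmul1l addE0.
- exact: gen_add.
- exists (addE f1 g1), (addE f2 g2); split; [exact: gen_add|exact: gen_add|].
  rewrite qmulDr mf mg qmulDl; apply: elt_ext => w; rewrite /addE; ring.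
- exact: gen_scale.
- exists (scaleE k f1), (scaleE k f2); split; [exact: gen_scale|exact: gen_scale|].
  rewrite qmulZr mf qmulZl; apply: elt_ext => w; rewrite /addE /scaleE; ring.
- by apply: gen_mul => //; apply: gen_base; exists x.
have Ex : gen_other a (ltr x) by apply: gen_base; exists x.
have Eax : gen_other a (ltr (rop a x)).
  by apply: gen_base; exists (rop a x); rewrite // eq_rop ropxx.
exists (scaleE t (ltr (rop a x) ** f1)),
  (addE (scaleE t (ltr (rop a x) ** f2))
        (scaleE (- t ^+ 2) (ltr x ** (ltr (rop a x) ** f)))); split.
- exact/gen_scale/gen_mul.
- by apply: gen_add; apply: gen_scale; apply: gen_mul => //; exact: gen_mul.
rewrite qmulA letter_quad 1?eq_sym // qmulDl !qmulZl -!qmulA mf qmulDr.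
by apply: elt_ext => w; rewrite /addE /scaleE; ring.
Qed.

Definition rder a f : elt K := fun w => f (rcons w a).

(** The last letter of a shuffle of x into a word is x or the unchanged last letter of that word; a
    final a is therefore the latter. *)
Lemma rder_mul_letter a x f : x != a -> rder a (ltr x ** f) = ltr x ** rder a f.
Proof.
move=> xa; apply: elt_ext => w; rewrite /rder.
elim: w f => [|z w IH] f; last by rewrite /= !mul_letter_cons IH.
by rewrite /= mul_letter_cons !mul_letter_nil (negPf xa) mul0r mulr0 addr0.
Qed.

Lemma rder_mul_other a e f : gen_other a e -> rder a (e ** f) = e ** rder a f.
Proof.
elim/gen_left_ind => [|e1 e2 H1 H2|k e1 H1|_ e1 [x xa ->] H1].
- by rewrite !qmul1l.
- by rewrite !qmulDl -H1 -H2.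
- by rewrite !qmulZl -H1.
by rewrite -!qmulA rder_mul_letter // H1.
Qed.

Lemma rder_pow a n : rder a (pow_word a n.+1) = pow_word a n.
Proof.
apply: elt_ext => w; rewrite /rder /pow_word.
have -> : nseq n.+1 a = rcons (nseq n a) a by elim: n => //= n <-.
by rewrite eqseq_rcons eqxx andbT.
Qed.

(* [filt a n f]: f = \sum_(i <= n) e_i * [pow_word a i] with all e_i in the   *)
(* subalgebra generated by the letters other than a.                          *)
Inductive filt a : nat -> elt K -> Prop :=
| filt0 f : gen_other a f -> filt a 0 f
| filtS n e f : gen_other a e -> filt a n f ->
    filt a n.+1 (addE f (e ** pow_word a n.+1)).

Lemma filt_widen a n f : filt a n f -> filt a n.+1 f.
Proof.
move=> Ff.
have -> : f = addE f ((fun=> 0) ** pow_word a n.+1) by rewrite qmul0l addE0.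
by apply: filtS => //; exact: gen0.
Qed.

Lemma filt_le a n m f : (n <= m)%N -> filt a n f -> filt a m f.
Proof.
by move=> /subnK <-; elim: (m - n)%N => // k IH Ff; exact/filt_widen/IH.
Qed.

Lemma filt_add a n f g : filt a n f -> filt a n g -> filt a n (addE f g).
Proof.
move=> Ff; elim: Ff g => [{}f Ef|{}n e {}f Ee Ff IH] g Fg; inversion Fg; subst.
  exact/filt0/gen_add.
have -> : addE (addE f (e ** pow_word a n.+1)) (addE f0 (e0 ** pow_word a n.+1)) =
    addE (addE f f0) (addE e e0 ** pow_word a n.+1).
  by rewrite qmulDl; apply: elt_ext => w; rewrite /addE; ring.
by apply: filtS; [exact: gen_add|exact: IH].
Qed.

Lemma filt_top a n e : gen_other a e -> filt a n (e ** pow_word a n).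
Proof.
case: n => [|n] Ee.
  apply: filt0; rewrite (_ : pow_word a 0 = one) ?qmul1r //.
rewrite -[_ ** _]addE0 (_ : addE _ _ = addE (fun=> 0) (e ** pow_word a n.+1)).
  by apply: filtS => //; apply/(filt_le (leq0n n))/filt0/gen0.
by apply: elt_ext => w; rewrite /addE addrC.
Qed.

Lemma filt_scale a n k f : filt a n f -> filt a n (scaleE k f).
Proof.
elim=> [{}f Ef|{}n e {}f Ee Ff IH]; first exact/filt0/gen_scale.
have -> : scaleE k (addE f (e ** pow_word a n.+1)) =
    addE (scaleE k f) (scaleE k e ** pow_word a n.+1).
  by rewrite qmulZl; apply: elt_ext => w; rewrite /addE /scaleE mulrDr.
by apply: filtS => //; exact: gen_scale.
Qed.

Lemma filt_mul_letter_top a n e : gen_other a e ->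
  filt a n.+1 (ltr a ** (e ** pow_word a n)).
Proof.
move=> /mul_letter_other[e1 [e2 [Ee1 Ee2 me]]].
rewrite qmulA me qmulDl -qmulA; have [c ->] := mul_letter_pow a n.
apply: filt_add; last exact/filt_widen/filt_top.
by rewrite qmulZr -qmulZl; apply/filt_top/gen_scale.
Qed.

Lemma filt_mul_letter a n x f : filt a n f -> filt a n.+1 (ltr x ** f).
Proof.
case: (eqVneq x a) => [->{x}|xa].
  elim=> [{}f Ef|{}n e {}f Ee Ff IH].
    by rewrite -[f]qmul1r; apply: (@filt_mul_letter_top a 0).
  by rewrite qmulDr; apply: filt_add; [exact: filt_widen|exact: filt_mul_letter_top].
have Ex : gen_other a (ltr x) by apply: gen_base; exists x.
move=> Ff; apply: filt_widen; elim: Ff => [{}f Ef|{}n e {}f Ee Ff IH].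
  exact/filt0/gen_mul.
by rewrite qmulDr qmulA; apply: filtS => //; exact: gen_mul.
Qed.

Lemma nichols_filt a f : nichols t f -> exists n, filt a n f.
Proof.
elim/nichols_ind => [|f1 f2 [n Hn] [m Hm]|k f1 [n Hn]|x f1 [n Hn]].
- by exists 0; exact/filt0/gen_one.
- by exists (maxn n m); apply: filt_add;
    [exact: filt_le (leq_maxl _ _) Hn|exact: filt_le (leq_maxr _ _) Hm].
- by exists n; exact: filt_scale.
by exists n.+1; exact: filt_mul_letter.
Qed.

Lemma rder_other a e : gen_other a e -> rder a e = fun=> 0.
Proof.
move=> Ee; rewrite -[e]qmul1r rder_mul_other // (_ : rder a one = fun=> 0) ?qmul0r //.
by apply: elt_ext => -[].
Qed.

Lemma iter_rder_add a k f g :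
  iter k (rder a) (addE f g) = addE (iter k (rder a) f) (iter k (rder a) g).
Proof. by elim: k => //= k ->. Qed.

Lemma iter_rder_top a n e : gen_other a e ->
  iter n (rder a) (e ** pow_word a n) = e.
Proof.
move=> Ee; elim: n => [|n IH]; last by rewrite iterSr rder_mul_other // rder_pow.
by rewrite (_ : pow_word a 0 = one) //= qmul1r.
Qed.

Lemma iter_rder_filt a n f : filt a n f -> iter n.+1 (rder a) f = fun=> 0.
Proof.
elim=> [{}f Ef|{}n e {}f Ee Ff IH]; first exact: rder_other.
rewrite iter_rder_add iterS IH iterS iter_rder_top // (rder_other Ee).
by apply: elt_ext => w; rewrite /addE /rder /= addr0.
Qed.

(** Stripping a is linear over [gen_other a] and lowers each [pow_word] by one, so repeated
    stripping isolates the top coefficient. That coefficient is thus 0, and induction on the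
    filtration applies. *)
Lemma rder0_gen_other a f : nichols t f -> rder a f = (fun=> 0) -> gen_other a f.
Proof.
move=> /(nichols_filt a)[n]; elim=> [//|{}n e {}f Ee Ff IH].
set h := addE _ _ => h0.
have e0 : e = fun=> 0.
  have <- : iter n.+1 (rder a) h = e.
    rewrite iter_rder_add iter_rder_filt // iter_rder_top //.
    by apply: elt_ext => w; rewrite /addE /= add0r.
  by rewrite iterSr h0; elim: n {h0 IH h Ff} => //= k ->.
by move: h0; rewrite /h e0 qmul0l addE0; exact: IH.
Qed.
End CubeRoot.

(** * Left coideal subalgebras *)

Section Coideal.
Variable C : elt K -> Prop.
Hypothesis coideal : left_coideal_subalg t C.

(** As [tr] is injective, [x] is the only word of its degree and length, so that component of f is
    f(x) v_x. *)
Lemma coideal_letter f x : C f -> f [:: x] != 0 -> C (ltr x).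
Proof.
case: coideal => _ [_ [_ [CZ [_ [_ [Cgpart _]]]]]] Cf fx.
have -> : ltr x = scaleE (f [:: x])^-1 (gpart (tr x) 1 f); last exact/CZ/Cgpart.
apply: elt_ext => w; rewrite /letter /scaleE /gpart andbC.
case: w => [|y [|z w]] /=; rewrite ?eqseq_cons ?andbF ?mulr0 //.
rewrite mulg1 (inj_eq tr_inj) andbT.
by case: eqP => [->|_]; rewrite ?mulVf ?mulr0.
Qed.

Lemma coideal_last f x w : C f -> ~ C (ltr x) -> f (rcons w x) = 0.
Proof.
case: coideal => _ [_ [_ [_ [_ [_ [_ CD]]]]]] /CD[n [b [c [bc Df]]]] nCx.
rewrite -cats1; rewrite /Delta in Df; rewrite Df big1 // => i _.
have [-> |cx] := eqVneq (c i [:: x]) 0; first by rewrite mulr0.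
by case: nCx; apply: coideal_letter cx; case: (bc i).
Qed.

(** Induction on length: splitting off the first letter leaves the words z b^k with z <> b. For k =
    0 use [coideal_last]; for k > 0, [nichols_quad] relates the value to values on two words whose
    tails are not powers of b. *)
Lemma coideal_restr (t3 : t ^+ 3 = -1) b f :
  (forall x, x != b -> ~ C (ltr x)) -> C f -> f = restr b f.
Proof.
move=> nC Cf; apply: elt_ext => w; rewrite /restr; case: ifP => // /negbT wb.
have [m] := ubnP (size w); elim: m => // m IH in f Cf w wb *.
have [n [c [d [cd Df]]]] : tens_in (nichols t) C (Delta f).
  by case: coideal => _ [_ [_ [_ [_ [_ [_]]]]]]; apply.
have tail z v : ~~ all (pred1 b) v -> (size v < m)%N -> f (z :: v) = 0.
  move=> vb lt_v; rewrite -cat1s; rewrite /Delta in Df; rewrite Df big1 // => i _.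
  by rewrite (IH (d i)) ?mulr0 //; case: (cd i).
case: w wb => // z v; rewrite ltnS => wb lt_v.
have [vb|] := boolP (all (pred1 b) v); last by move=> vb; exact: tail.
have zb : z != b by apply: contra wb => /= ->.
case: v vb lt_v {wb} => [_ _|y v /= /andP[/eqP-> vb] lt_v].
  by apply: (@coideal_last _ _ [::]) => //; exact: nC.
(* Contracting the right factor of Delta f against v leaves an element of the Nichols algebra. *)
pose h : elt K := fun u => f (u ++ v).
have Bh : nichols t h.
  rewrite (_ : h = fun u => \sum_i scaleE (d i v) (c i) u).
    by apply: gen_sum => i; apply: gen_scale; case: (cd i).
  apply: elt_ext => u; rewrite /h; rewrite /Delta in Df; rewrite Df.
  by apply: eq_bigr => i _; rewrite mulrC.
have := nichols_quad t3 Bh zb; rewrite /h /=.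
rewrite (tail (rop z b)) ?(tail b) /= ?negb_and ?zb // ?mulr0 ?addr0 //.
by rewrite rop_neq.
Qed.

Lemma coideal_gen_in_degree_one (t3 : t ^+ 3 = -1) : gen_in_degree_one t C.
Proof.
have [CB [C1 [CD [CZ [CM _]]]]] := coideal.
move=> f; split; last by elim=> // [g []|||] *; auto.
move=> Cf; have Bf := CB f Cf.
have base x : C (ltr x) -> gen t (fun g => C g /\ homog 1 g) (ltr x).
  move=> Cx; apply: gen_base; split=> // w; rewrite /letter.
  by case: (w =P [:: x]) => // ->.
have [Call|/not_all_ex_not[a nCa]] := classic (forall x, C (ltr x)).
  by apply: gen_sub Bf => _ [x ->]; exact: base.
have [Coth|/not_all_ex_not[c nC]] := classic (forall x, x != a -> C (ltr x)).
  have /(rder0_gen_other t3 Bf) : rder a f = fun=> 0.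
    by apply: elt_ext => w; apply: coideal_last.
  by apply: gen_sub => _ [x xa ->]; exact/base/Coth.
have [ca nCc] := imply_to_and _ _ nC.
(* Both a and c are missing, so only the third letter can lie in C. *)
have {}nC x : x != rop a c -> ~ C (ltr x).
  have [-> //|xa] := eqVneq x a; have [-> //|xc] := eqVneq x c.
  by rewrite -(rop_third _ xa xc) ?eqxx // eq_sym.
have fr := coideal_restr t3 nC Cf.
have [Cb|nCb] := classic (C (ltr (rop a c))).
  by rewrite fr; apply: gen_sub (restr_nichols (rop a c) Bf) => _ ->; exact: base.
have -> : f = scaleE (f [::]) one; last exact/gen_scale/gen_one.
apply: elt_ext => w; rewrite /scaleE; case/lastP: w => [|w x].
  by rewrite mulr1.
rewrite /Defs.one -size_eq0 size_rcons mulr0; apply: coideal_last => //.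
by have [->|/nC] := eqVneq x (rop a c).
Qed.

End Coideal.

(** * The subalgebra generated by v_b and w2 *)

Local Notation C2 := (C2 t).
Local Notation w2 := (w2 t).

Lemma mul_w2 f : w2 ** f =
  addE (addE (ltr 0 ** (ltr 1 ** f)) (scaleE (- t) (ltr 2 ** (ltr 0 ** f))))
       (scaleE (t ^+ 2) (ltr 1 ** (ltr 2 ** f))).
Proof. by rewrite /w2 !qmulDl !qmulZl -!qmulA. Qed.

Lemma nichols_letter x : nichols t (ltr x).
Proof. by apply: gen_base; exists x. Qed.

Lemma nichols_w2 : nichols t w2.
Proof.
by apply: gen_add; [apply: gen_add|]; try apply: gen_scale; apply: gen_mul;
  exact: nichols_letter.
Qed.

Lemma C2_vb : C2 (ltr 1).
Proof. by apply: gen_base; left. Qed.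

Lemma C2_w2 : C2 w2.
Proof. by apply: gen_base; right. Qed.

Lemma C2_nichols f : C2 f -> nichols t f.
Proof.
by apply: gen_sub => _ [] ->; [exact: nichols_letter|exact: nichols_w2].
Qed.

(** Covers [hpart] and [gpart] at once, and is stable under prefixing a letter, as the induction for
    [C2_part] requires. *)
Definition graded (Q : word -> bool) :=
  forall u v, gdeg u = gdeg v -> size u = size v -> Q u = Q v.

Definition part (Q : word -> bool) f : elt K := fun w => if Q w then f w else 0.

Lemma graded_cons Q x : graded Q -> graded (fun w => Q (x :: w)).
Proof. by move=> gQ u v duv suv; apply: gQ; rewrite /= ?duv ?suv. Qed.

Lemma part_add Q f g : part Q (addE f g) = addE (part Q f) (part Q g).
Proof. by apply: elt_ext => w; rewrite /part /addE; case: ifP; rewrite ?addr0. Qed.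

Lemma part_scale Q a f : part Q (scaleE a f) = scaleE a (part Q f).
Proof. by apply: elt_ext => w; rewrite /part /scaleE; case: ifP; rewrite ?mulr0. Qed.

Lemma part_mul_letter Q x f : graded Q ->
  part Q (ltr x ** f) = ltr x ** part (fun w => Q (x :: w)) f.
Proof.
move=> gQ; apply: elt_ext => w; elim: w => [|z w IH] in Q x f gQ *.
  by rewrite /part !mul_letter_nil if_same.
have -> : part Q (ltr x ** f) (z :: w) =
    (x == z)%:R * part (fun w => Q (z :: w)) f w +
    t * part (fun w => Q (z :: w)) (ltr x ** lder (rop x z) f) w.
  by rewrite /part mul_letter_cons; case: ifP; rewrite // !mulr0 addr0.
rewrite mul_letter_cons IH; last exact: graded_cons.
congr (_ + t * _); first by case: eqP => [->|]; rewrite ?mul0r.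
congr (Defs.mul t _ _ w); apply: elt_ext => u; rewrite /part /lder.
by rewrite (gQ (z :: x :: u) (x :: rop x z :: u)) // [in RHS]gdeg_swap ropK.
Qed.

Lemma C2_part Q f : graded Q -> C2 f -> C2 (part Q f).
Proof.
move=> gQ Cf; elim/gen_left_ind: f / Cf Q gQ => [|f g Hf Hg|a f Hf|s f Ss Hf] Q gQ.
- have -> : part Q one = scaleE (Q [::])%:R one.
    by apply: elt_ext => -[|x w]; rewrite /part /scaleE /=;
      case: (Q _); rewrite ?mul1r ?mul0r ?mulr0.
  exact/gen_scale/gen_one.
- by rewrite part_add; apply: gen_add; [exact: Hf|exact: Hg].
- by rewrite part_scale; apply/gen_scale/Hf.
have gQ1 x : graded (fun w => Q (x :: w)) by exact: graded_cons.
have gQ2 x y : graded (fun w => Q [:: x, y & w]) by exact: (graded_cons y (gQ1 x)).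
case: Ss => ->.
  by rewrite part_mul_letter //; apply: gen_mul C2_vb _; exact: Hf.
rewrite mul_w2 !part_add !part_scale !part_mul_letter //.
(* The words ab, ca and bc have the same degree, so w2 factors out again. *)
have <- : (fun w => Q [:: 0, 1 & w]) = fun w => Q [:: 2, 0 & w].
  by apply: functional_extensionality => w; apply: gQ; rewrite // gdeg_swap ropE.
have <- : (fun w => Q [:: 0, 1 & w]) = fun w => Q [:: 1, 2 & w].
  apply: functional_extensionality => w; apply: gQ; rewrite // gdeg_swap ropE.
  by rewrite gdeg_swap ropE.
by rewrite -mul_w2; apply: gen_mul C2_w2 _; exact: Hf.
Qed.

(** * The group action and the coproduct of [C2] *)

(** The action of g_x; no inverse appears on words because [rop x] is an involution. *)
Definition translate x f : elt K := fun u => t ^+ size u * f (map (rop x) u).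

Lemma lder_translate x z f :
  lder z (translate x f) = scaleE t (translate x (lder (rop x z) f)).
Proof. by apply: elt_ext => w; rewrite /lder /translate /scaleE /= exprS mulrA. Qed.

Lemma translate_mul_letter x y f :
  translate x (ltr y ** f) = scaleE t (ltr (rop x y) ** translate x f).
Proof.
apply: elt_ext => w; elim: w f => [|z w IH] f.
  by rewrite /translate /scaleE /= !mul_letter_nil !mulr0.
have -> : translate x (ltr y ** f) (z :: w) =
    t * ((y == rop x z)%:R * translate x f w +
         t * translate x (ltr y ** lder (rop y (rop x z)) f) w).
  by rewrite /translate /= mul_letter_cons exprS; ring.
rewrite IH /scaleE mul_letter_cons lder_translate qmulZr eq_rop.
rewrite (rop_distr x (rop x y)) ropK.
by rewrite /scaleE; ring.
Qed.

Lemma translate_nichols x f : nichols t f -> nichols t (translate x f).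
Proof.
elim/nichols_ind => [|f1 f2 H1 H2|a f1 H1|y f1 H1].
- have -> : translate x one = one.
    by apply: elt_ext => -[|z w]; rewrite /translate /= ?mulr0 // mul1r.
  exact: gen_one.
- have -> : translate x (addE f1 f2) = addE (translate x f1) (translate x f2).
    by apply: elt_ext => w; rewrite /translate /addE mulrDr.
  exact: gen_add.
- have -> : translate x (scaleE a f1) = scaleE a (translate x f1).
    by apply: elt_ext => w; rewrite /translate /scaleE mulrCA.
  exact: gen_scale.
rewrite translate_mul_letter.
by apply/gen_scale/gen_mul => //; exact: nichols_letter.
Qed.

(* Left multiplication by Delta v_x = v_x (x) 1 + 1 (x) v_x in the braided    *)
(* tensor square; 1 (x) v_x braids across the first factor.                   *)
Definition Delta_act x (F : word -> word -> K) : word -> word -> K := fun u v =>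
  (ltr x ** (fun u' => F u' v)) u + t ^+ size u * (ltr x ** F (map (rop x) u)) v.

Lemma Delta_mul_letter x f u v :
  Delta (ltr x ** f) u v = Delta_act x (Delta f) u v.
Proof.
rewrite /Delta_act /Delta; elim: u f => [|z u IH] f.
  by rewrite mul_letter_nil add0r mul1r.
by rewrite /= !mul_letter_cons IH exprS mulrDr -!mulrA addrA.
Qed.

Lemma Delta_act_sum x n (F : 'I_n -> word -> word -> K) u v :
  Delta_act x (fun u v => \sum_i F i u v) u v = \sum_i Delta_act x (F i) u v.
Proof.
rewrite /Delta_act (qmul_sumr (fun i u' => F i u' v)).
by rewrite (qmul_sumr (fun i => F i (map (rop x) u))) mulr_sumr -big_split.
Qed.

(** Two summands, because one letter already turns a pure tensor into a sum of two. *)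
Lemma Delta_act_pure x (b c b' c' : elt K) u v :
  Delta_act x (fun u v => b u * c v + b' u * c' v) u v =
  (ltr x ** b) u * c v + translate x b u * (ltr x ** c) v +
  ((ltr x ** b') u * c' v + translate x b' u * (ltr x ** c') v).
Proof.
have dec (k k' : K) f f' w : (ltr x ** (fun u => k * f u + k' * f' u)) w =
    k * (ltr x ** f) w + k' * (ltr x ** f') w.
  rewrite -[RHS]/(addE (scaleE k (ltr x ** f)) (scaleE k' (ltr x ** f')) w).
  by rewrite -!qmulZr -qmulDr.
rewrite /Delta_act dec /translate.
rewrite (_ : (fun u' => b u' * c v + b' u' * c' v) =
             fun u' => c v * b u' + c' v * b' u') ?dec; first by ring.
by apply: elt_ext => w; rewrite mulrC [b' _ * _]mulrC.
Qed.

Lemma Delta_act_tens x n (b c : 'I_n -> elt K) (F : word -> word -> K) :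
  (forall u v, F u v = \sum_i b i u * c i v) ->
  forall u v, Delta_act x F u v =
    \sum_i ((ltr x ** b i) u * c i v + translate x (b i) u * (ltr x ** c i) v).
Proof.
move=> DF u v.
have -> : F = fun u v => \sum_i (b i u * c i v + 0 * 0).
  apply: functional_extensionality => u'; apply: elt_ext => v'; rewrite DF.
  by apply: eq_bigr => i _; rewrite mulr0 addr0.
rewrite Delta_act_sum; apply: eq_bigr => i _.
by rewrite (Delta_act_pure x (b i) (c i) (fun=> 0) (fun=> 0)) qmul0r !mulr0 !addr0.
Qed.

Lemma translate_comp x y f :
  translate x (translate y f) = translate (rop x y) (translate x f).
Proof.
apply: elt_ext => w; rewrite /translate !size_map -!map_comp; congr (_ * (_ * f _)).
by apply: eq_map => z /=; rewrite [RHS]rop_distr ropK.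
Qed.

(** The mixed terms of the three monomials telescope: those with v_a or v_c on the right cancel, and
    v_b collects 1 + t^3. In the last sum g_a g_b, the common degree of the monomials, acts on the
    left factor. *)
Lemma Delta_mul_w2 n (b c : 'I_n -> elt K) f :
  (forall u v, Delta f u v = \sum_i b i u * c i v) ->
  forall u v, Delta (w2 ** f) u v =
    \sum_i (w2 ** b i) u * c i v +
    (\sum_i (scaleE (1 + t ^+ 3) (ltr 0 ** translate 1 (b i))) u * (ltr 1 ** c i) v +
     \sum_i translate 0 (translate 1 (b i)) u * (w2 ** c i) v).
Proof.
move=> Df u v; rewrite mul_w2.
have two x y : Delta (ltr x ** (ltr y ** f)) u v = \sum_i
   ((ltr x ** (ltr y ** b i)) u * c i v + translate x (ltr y ** b i) u * (ltr x ** c i) v +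
   ((ltr x ** translate y (b i)) u * (ltr y ** c i) v +
    translate x (translate y (b i)) u * (ltr x ** (ltr y ** c i)) v)).
  rewrite Delta_mul_letter.
  have -> : Delta (ltr y ** f) = fun u v => \sum_i
      ((ltr y ** b i) u * c i v + translate y (b i) u * (ltr y ** c i) v).
    apply: functional_extensionality => u'; apply: elt_ext => v'.
    by rewrite Delta_mul_letter; exact: Delta_act_tens.
  by rewrite Delta_act_sum; apply: eq_bigr => i _; exact: Delta_act_pure.
rewrite -[LHS]/(Delta _ u v + - t * Delta _ u v + t ^+ 2 * Delta _ u v) !two.
rewrite !mulr_sumr -!big_split; apply: eq_bigr => i _ /=.
rewrite !translate_mul_letter !ropE.
rewrite (translate_comp 1 2) ropE (translate_comp 0 1) ropE !mul_w2 /addE /scaleE.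
by ring.
Qed.

Lemma tens_in_add (P Q : elt K -> Prop) F G : tens_in P Q F -> tens_in P Q G ->
  tens_in P Q (fun u v => F u v + G u v).
Proof.
move=> [n [b [c [bc DF]]]] [m [b' [c' [bc' DG]]]].
exists (n + m)%N, (fun i => match split i with inl j => b j | inr j => b' j end),
  (fun i => match split i with inl j => c j | inr j => c' j end); split.
  by move=> i; case: split.
move=> u v; rewrite DF DG big_split_ord; congr (_ + _); apply: eq_bigr => i _.
  by rewrite (unsplitK (inl i : 'I_n + 'I_m)).
by rewrite (unsplitK (inr i : 'I_n + 'I_m)).
Qed.

Lemma C2_coideal f : C2 f -> tens_in (nichols t) C2 (Delta f).
Proof.
have ext F G : (forall u v, F u v = G u v) -> tens_in (nichols t) C2 F ->
    tens_in (nichols t) C2 G.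
  by move=> FG [n [b [c [bc DF]]]]; exists n, b, c; split=> // u v; rewrite -FG.
elim/gen_left_ind => [|f1 f2 H1 H2|a f1 [n [b [c [bc Df]]]]|s f1 Ss [n [b [c [bc Df]]]]].
- exists 1%N, (fun=> one), (fun=> one); split; first by split; exact: gen_one.
  by move=> [|x u] v; rewrite big_ord1 /Delta /Defs.one /= ?mul1r ?mul0r.
- exact: tens_in_add.
- exists n, (fun i => scaleE a (b i)), c; split.
    by move=> i; have [Bb Cc] := bc i; split=> //; exact: gen_scale.
  move=> u v; rewrite -[LHS]/(a * Delta f1 u v) Df mulr_sumr.
  by apply: eq_bigr => i _; rewrite /scaleE mulrA.
case: Ss => ->.
  pose F u v := \sum_i (ltr 1 ** b i) u * c i v.
  pose G u v := \sum_i translate 1 (b i) u * (ltr 1 ** c i) v.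
  apply: (ext (fun u v => F u v + G u v)).
    by move=> u v; rewrite Delta_mul_letter (Delta_act_tens _ Df) -big_split.
  apply: tens_in_add.
    exists n, (fun i => ltr 1 ** b i), c; split=> // i; have [Bb Cc] := bc i.
    by split=> //; apply: gen_mul Bb; exact: nichols_letter.
  exists n, (fun i => translate 1 (b i)), (fun i => ltr 1 ** c i); split=> // i.
  have [Bb Cc] := bc i; split; [exact: translate_nichols|exact: gen_mul C2_vb Cc].
apply: ext (fun u v => esym (Delta_mul_w2 Df u v)) _.
apply: tens_in_add; last apply: tens_in_add.
- exists n, (fun i => w2 ** b i), c; split=> // i; have [Bb Cc] := bc i.
  by split=> //; exact: gen_mul nichols_w2 Bb.
- exists n, (fun i => scaleE (1 + t ^+ 3) (ltr 0 ** translate 1 (b i))),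
    (fun i => ltr 1 ** c i); split=> // i; have [Bb Cc] := bc i; split.
    apply/gen_scale/gen_mul; [exact: nichols_letter|exact: translate_nichols].
  exact: gen_mul C2_vb Cc.
exists n, (fun i => translate 0 (translate 1 (b i))), (fun i => w2 ** c i).
split=> // i; have [Bb Cc] := bc i; split; first by do 2!apply: translate_nichols.
exact: gen_mul C2_w2 Cc.
Qed.

Lemma C2_left_coideal_subalg : left_coideal_subalg t C2.
Proof.
split; first exact: C2_nichols.
split; first exact: gen_one.
split; first exact: gen_add.
split; first exact: gen_scale.
split; first exact: gen_mul.
split; first by move=> n f; apply: C2_part => u v _ ->.
split; last exact: C2_coideal.
by move=> s n f; apply: C2_part => u v -> ->.
Qed.

(** * Failure of generation in degree one *)

Lemma C2_degree1 f x : C2 f -> x != 1 -> f [:: x] = 0.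
Proof.
move=> Cf x1; elim/gen_left_ind: f / Cf => [|f g Hf Hg|a f Hf|s f Ss _] //.
- by rewrite /addE Hf Hg addr0.
- by rewrite /scaleE Hf mulr0.
case: Ss => ->.
  by rewrite mul_letter1 eq_sym (negPf x1) mul0r.
by rewrite mul_w2 /addE /scaleE !mul_letter1 !mul_letter_nil !mulr0 !addr0.
Qed.

Lemma w2_ab : w2 [:: 0; 1] = 1 + t ^+ 3.
Proof. by rewrite /w2 /addE /scaleE !mul_letters !ropE /=; ring. Qed.

Lemma C2_not_gen_in_degree_one : 1 + t ^+ 3 != 0 -> ~ gen_in_degree_one t C2.
Proof.
move=> t3 /(_ w2)[/(_ C2_w2) w2gen _]; case/eqP: t3; rewrite -w2_ab.
(* The degree-one vanishing is carried along because the value of v_b f on ab is t f(c). *)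
suff [] : (forall x, x != 1 -> w2 [:: x] = 0) /\ w2 [:: 0; 1] = 0 by [].
elim/gen_left_ind: _ / w2gen => [|f g [f1 f2] [g1 g2]|a f [f1 f2]|s f [Cs Hs] [f1 f2]].
- by [].
- by split=> [x x1|]; rewrite /addE ?f1 ?g1 ?f2 ?g2 ?addr0.
- by split=> [x x1|]; rewrite /scaleE ?f1 ?f2 ?mulr0.
(* By [C2_degree1], a degree-one generator is a multiple of v_b. *)
have -> : s = scaleE (s [:: 1]) (ltr 1).
  apply: elt_ext => w; rewrite /scaleE /letter; case: w => [|x [|y w]].
  - by rewrite Hs // mulr0.
  - rewrite eqseq_cons andbT; have [->|x1] := eqVneq x 1; first by rewrite mulr1.
    by rewrite (C2_degree1 Cs) // mulr0.
  - by rewrite Hs // eqseq_cons andbF mulr0.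
rewrite qmulZl /scaleE; split=> [x x1|].
  by rewrite mul_letter1 eq_sym (negPf x1) mul0r mulr0.
by rewrite mul_letter2 ropE /= [f [:: 2]]f1 // mul0r !mulr0 addr0 mulr0.
Qed.

End QuantumShuffle.

Theorem mainTheorem14 (K : closedFieldType) (char0 : [pchar K] =i pred0)
  (t : K) (t_neq0 : t != 0) :
  ((t = -1 \/ t ^+ 2 - t + 1 = 0) ->
     forall C : elt K -> Prop,
       left_coideal_subalg t C -> gen_in_degree_one t C) /\
  (t != -1 -> t ^+ 2 - t + 1 != 0 ->
     left_coideal_subalg t (C2 t) /\ ~ gen_in_degree_one t (C2 t)).
Proof.
have t3E : 1 + t ^+ 3 = (t + 1) * (t ^+ 2 - t + 1) by ring.
split=> [t3 C coC|t1 t2].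
  apply: coideal_gen_in_degree_one => //; apply/eqP.
  rewrite -subr_eq0 opprK addrC t3E mulf_eq0.
  by case: t3 => [->|->]; rewrite ?addNr eqxx ?orbT.
split; first exact: C2_left_coideal_subalg.
by apply: C2_not_gen_in_degree_one; rewrite t3E mulf_neq0 // addr_eq0.
Qed.
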